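(* Let $G$ be a cubic graph which has a $1$-factor. If $G \neq K_2^3$, then $\{3,4\} \subseteq {\cal S}(G) \cap \overline{{\cal S}}(G)$.
   Context: Graphs are finite and may have parallel edges but no loops. A $1$-factor is a spanning $1$-regular subgraph. $K_2^3$ is the cubic graph on two vertices which are connected by three parallel edges. A signed graph $(G,\sigma)$ is a graph $G$ with a function (signature) $\sigma: E(G)\to\{\pm1\}$. Each edge $e=uv$ is divided into two half-edges $h_e^u$ (incident with $u$) and $h_e^v$ (incident with $v$); $H(G)$ is the set of half-edges, $H(v)$ the set of half-edges incident with $v$, and $e_h$ the edge containing the half-edge $h$. An orientation of $(G,\sigma)$ is a function $\tau: H(G)\to\{\pm1\}$ with $\tau(h_e^u)\tau(h_e^v) = -\sigma(e)$ for each edge $e=uv$. Given an orientation $\tau$, the boundary of $f:E(G)\to\mathbb{R}$ is $\delta f(v)=\sum_{h\in H(v)}\tau(h)f(e_h)$. For real $r\ge 2$, $f$ is an $r$-flow on $(G,\sigma)$ if, for every edge $e$, $f(e)=0$ or $1\le |f(e)|\le r-1$, and $\delta f(v)=0$ for all $v\in V(G)$; it is nowhere-zero if $f(e)\ne 0$ for all $e$. $(G,\sigma)$ admits a nowhere-zero $r$-flow if one exists for some orientation, and $(G,\sigma)$ is flow-admissible if it admits a nowhere-zero $r$-flow for some $r\ge2$. $F_c((G,\sigma))=\inf\{r : (G,\sigma)\text{ admits a nowhere-zero }r\text{-flow}\}$, and $F((G,\sigma))$ is the smallest integer $k$ such that $(G,\sigma)$ admits an integer-valued nowhere-zero $k$-flow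 (both are $\infty$ if $(G,\sigma)$ is not flow-admissible). The flow spectrum ${\cal S}(G)$ is the set of all $F_c((G,\sigma))$, and the integer flow spectrum $\overline{{\cal S}}(G)$ the set of all $F((G,\sigma))$, where $\sigma$ ranges over all signatures of $G$ for which $(G,\sigma)$ is flow-admissible.
   Formalization: Besides K_2^3 itself, the formal theorem excludes the empty graph and disjoint unions of two or more copies of K_2^3; graphs are not assumed connected, and the claim fails for these (flow number 2 for the empty graph; spectrum {3} for the unions). *)

(* Defs.v *)
From HB Require Import structures.
From mathcomp Require Import all_boot all_order all_algebra.
From mathcomp Require Import boolp classical_sets reals constructive_ereal ereal.

Set Implicit Arguments.
Unset Strict Implicit.
Unset Printing Implicit Defensive.

Import Order.TTheory GRing.Theory Num.Theory.

Local Open Scope ring_scope.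

(* Finite loopless multigraphs: every edge has exactly two distinct ends, and
   parallel edges are distinct elements of [edge G] with the same ends. *)
Record mgraph := MGraph {
  vert : finType;
  edge : finType;
  ends : edge -> {set vert};
  card_ends : forall e : edge, #|ends e| = 2%N
}.

(* Since there are no loops, incident edges are counted without multiplicity. *)
Definition cubic (G : mgraph) : Prop :=
  forall v : vert G, #|[set e | v \in ends e]| = 3%N.

Definition one_factor (G : mgraph) (M : {set edge G}) : Prop :=
  forall v : vert G, #|[set e in M | v \in ends e]| = 1%N.

Definition mgraph_iso (G H : mgraph) : Prop :=
  exists (phi : vert G -> vert H) (psi : edge G -> edge H),
    [/\ bijective phi, bijective psi &
        forall e : edge G, ends (psi e) = phi @: ends e].

Lemma card_ends_K23 (e : 'I_3) : #|[set: 'I_2]| = 2%N.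
Proof. by rewrite cardsT card_ord. Qed.

Definition K23 : mgraph := MGraph card_ends_K23.

Lemma card_ends_copies (n : nat) (G : mgraph) (p : 'I_n * edge G) :
  #|[set (p.1, v) | v in ends p.2]| = 2%N.
Proof. by rewrite card_imset ?card_ends // => u v []. Qed.

(* The disjoint union of [n] copies of [G]; it is empty for [n = 0] and
   isomorphic to [G] for [n = 1]. As graphs need not be connected, excluding
   [K23] has to mean excluding every [copies n K23]: flow numbers of a disjoint
   union are maxima over its components and 3 is the only flow number of [K23],
   so no signature of [copies n K23] has flow number 4. *)
Definition copies (n : nat) (G : mgraph) : mgraph :=
  MGraph (@card_ends_copies n G).

(* As there are no loops, the half-edges of [e] are the pairs [(e, v)] with
   [v] an end of [e]. *)
Definition half_edge (G : mgraph) : finType :=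
  {h : edge G * vert G | h.2 \in ends h.1}.

Definition edge_of (G : mgraph) (h : half_edge G) : edge G := (val h).1.
Definition vert_of (G : mgraph) (h : half_edge G) : vert G := (val h).2.

(* An element of {+1, -1} is encoded by a boolean [b] standing for
   [(-1) ^+ b]: [false] is [+1] and [true] is [-1]. *)
Definition signature (G : mgraph) : Type := edge G -> bool.

Definition orientation (G : mgraph) (sigma : signature G)
    (tau : half_edge G -> bool) : Prop :=
  forall h h' : half_edge G, h != h' -> edge_of h = edge_of h' ->
    (-1) ^+ tau h * (-1) ^+ tau h' = - (-1) ^+ sigma (edge_of h) :> int.

Section Flows.
Variable R : realType.

Definition boundary (G : mgraph) (tau : half_edge G -> bool)
    (f : edge G -> R) (v : vert G) : R :=
  \sum_(h : half_edge G | vert_of h == v) (-1) ^+ tau h * f (edge_of h).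

Definition is_flow (G : mgraph) (tau : half_edge G -> bool) (r : R)
    (f : edge G -> R) : Prop :=
  [/\ 2 <= r,
      forall e : edge G, f e = 0 \/ 1 <= `|f e| <= r - 1 &
      forall v : vert G, boundary tau f v = 0].

Definition nowhere_zero (G : mgraph) (f : edge G -> R) : Prop :=
  forall e : edge G, f e != 0.

Definition admits_nzf (G : mgraph) (sigma : signature G) (r : R) : Prop :=
  exists (tau : half_edge G -> bool) (f : edge G -> R),
    [/\ orientation sigma tau, is_flow tau r f & nowhere_zero f].

Definition admits_int_nzf (G : mgraph) (sigma : signature G) (k : nat) : Prop :=
  exists (tau : half_edge G -> bool) (f : edge G -> R),
    [/\ orientation sigma tau, is_flow tau k%:R f, nowhere_zero f &
        forall e : edge G, f e \is a Num.int].

Definition flow_admissible (G : mgraph) (sigma : signature G) : Prop :=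
  exists r : R, admits_nzf sigma r.

Local Open Scope classical_set_scope.

(* [ereal_inf set0 = +oo]. *)
Definition circular_flow_number (G : mgraph) (sigma : signature G) : \bar R :=
  ereal_inf [set r%:E | r in [set r : R | admits_nzf sigma r]].

Definition int_flow_number (G : mgraph) (sigma : signature G) : \bar R :=
  if pselect (exists k : nat, `[< admits_int_nzf sigma k >]) is left ex
  then (ex_minn ex)%:R%:E else +oo%E.

Definition flow_spectrum (G : mgraph) : set R :=
  [set x : R | exists sigma : signature G,
     flow_admissible sigma /\ circular_flow_number sigma = x%:E].

Definition int_flow_spectrum (G : mgraph) : set R :=
  [set x : R | exists sigma : signature G,
     flow_admissible sigma /\ int_flow_number sigma = x%:E].

End Flows.

(* Main.v *)
Require Import Defs.
From HB Require Import structures.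
From mathcomp Require Import all_boot all_order all_algebra.
From mathcomp Require Import boolp classical_sets reals constructive_ereal ereal.
From mathcomp Require Import lra.

Set Implicit Arguments.
Unset Strict Implicit.
Unset Printing Implicit Defensive.

Import Order.TTheory GRing.Theory Num.Theory.

Local Open Scope ring_scope.

(** Three reals of absolute value at least 1 with sum 0 include one of absolute
value at least 2, so every nowhere-zero flow on a nonempty cubic graph needs
[r >= 3]. If [r < 4], all absolute values are below 3; at each vertex exactly
one edge then has absolute value at least 2, and its half-edge is signed
opposite to the two others. The signature is thus determined by one sign per
vertex: it is switching equivalent to the signature with all edges negative
([nzf_lt4_antibalanced]). Hence it is enough to find an integer 3-flow, and an
integer 4-flow on a signature that is not antibalanced.

Conversely, choose positive values on the edges and at each vertex a top edge
whose value is the sum of the two others. Orienting the top half-edges against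
the others gives a flow, for the signature in which an edge is positive when it
is the top edge of exactly one of its ends ([top_signature_nzf]). Given
a 1-factor [M], the values 2 on [M] and 1 elsewhere give a 3-flow. Raising one
edge [e0] outside [M] to the value 3, as the new top edge of its ends, gives
a 4-flow whose positive edges are the edges of [M] with exactly one end in
[e0]. This signature is antibalanced iff these edges form an edge cut.

Suppose that this happens for all [M] and [e0]. Fix [M]. Combining two cuts for
adjacent [e0], or one such cut with a cut by a single edge of [M], gives
smaller cuts; it follows that no single edge of [M] is a cut, and then that the
two edges outside [M] at a vertex are always parallel ([digons_off_factor]).
Choosing one edge from each of these digons gives a 1-factor disjoint from [M],
to which the same conclusion applies, so that all three edges at every vertex
are parallel ([all_shared_ends]), and the graph is a disjoint union of copies
of the cubic graph on two vertices, which is excluded. *)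

(** * Parity of a vertex labelling along an edge *)

(** The edges of parity [true] form the edge cut of the vertex set [s]. *)
Definition parity (G : mgraph) (s : vert G -> bool) (e : edge G) : bool :=
  \big[addb/false]_(v in ends e) s v.

(** Switching at the vertices of [s] makes every edge negative. *)
Definition antibalanced (G : mgraph) (sigma : signature G) : Prop :=
  exists s : vert G -> bool, forall e, sigma e = ~~ parity s e.

Section Incidence.
Variable G : mgraph.
Implicit Types (e : edge G) (u v w : vert G) (s : vert G -> bool).

Lemma ends_at e u : u \in ends e -> exists2 w, ends e = [set u; w]%SET & u != w.
Proof.
move=> ue; have : #|ends e :\ u| == 1%N.
  move: (cardsD1 u (ends e)); rewrite ue card_ends => /eqP.
  by rewrite add1n eqSS eq_sym.
case/cards1P=> w ew; exists w; first by rewrite -ew finset.setD1K.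
by have := set11 w; rewrite -ew !inE eq_sym => /andP[].
Qed.

Lemma endsP e : exists u w, ends e = [set u; w]%SET /\ u != w.
Proof.
have /card_gt0P[u ue] : (0 < #|ends e|)%N by rewrite card_ends.
by have [w ew uw] := ends_at ue; exists u, w.
Qed.

Lemma parityE s e u w :
  ends e = [set u; w]%SET -> u != w -> parity s e = s u (+) s w.
Proof. by move=> ew uw; rewrite /parity ew big_setU1 ?inE // big_set1. Qed.

Lemma eq_parity s s' e : {in ends e, s =1 s'} -> parity s e = parity s' e.
Proof. by move=> ss'; apply: eq_bigr. Qed.

(** Half-edges as pairs of an edge and a vertex, so that sums over half-edges
become sums over edges; pairs that are not incident get a junk value. *)
Definition tau_at (tau : half_edge G -> bool) e v : bool :=
  if insub (e, v) is Some h then tau h else false.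

Lemma tau_atE tau (h : half_edge G) :
  tau_at tau (edge_of h) (vert_of h) = tau h.
Proof. by rewrite /tau_at -surjective_pairing valK. Qed.

Lemma tau_at_mk (t : edge G -> vert G -> bool) e v : v \in ends e ->
  tau_at (fun h => t (edge_of h) (vert_of h)) e v = t e v.
Proof. by move=> ve; rewrite /tau_at insubT. Qed.

Lemma orientationE (sigma : signature G) tau :
  orientation sigma tau <-> forall e, sigma e = ~~ parity (tau_at tau e) e.
Proof.
have sgn_eq (a b c : bool) :
    ((-1) ^+ a * (-1) ^+ b = - (-1) ^+ c :> int) <-> c = ~~ (a (+) b).
  by case: a; case: b; case: c.
split=> [ori e | sE h h' hh' ehh'].
  have [u [w [ew uw]]] := endsP e.
  have ue : (e, u).2 \in ends (e, u).1 by rewrite ew !inE eqxx.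
  have we : (e, w).2 \in ends (e, w).1 by rewrite ew !inE eqxx orbT.
  pose h : half_edge G := exist _ (e, u) ue.
  pose h' : half_edge G := exist _ (e, w) we.
  rewrite (parityE _ ew uw) (tau_atE tau h) (tau_atE tau h').
  apply/sgn_eq/(ori h h') => //.
  by apply: contraNneq uw => hh'; apply/eqP; apply: (congr1 (@vert_of G) hh').
apply/sgn_eq; rewrite sE.
have nv : vert_of h != vert_of h'.
  apply: contraNneq hh' => vhh'; apply/eqP/val_inj.
  by rewrite [LHS]surjective_pairing [RHS]surjective_pairing; congr pair.
have [w ew uw] := ends_at (valP h).
have : vert_of h' \in ends (edge_of h) by rewrite ehh'; apply: (valP h').
rewrite ew !inE (eq_sym _ (val h).2) (negbTE nv) /= => /eqP wE.
by rewrite (parityE _ ew uw) -wE tau_atE ehh' tau_atE.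
Qed.

Lemma boundaryE (R : realType) tau (f : edge G -> R) v :
  boundary tau f v = \sum_(e | v \in ends e) (-1) ^+ tau_at tau e v * f e.
Proof.
rewrite /boundary.
transitivity (\sum_(h : half_edge G | vert_of h == v)
    (-1) ^+ tau_at tau (edge_of h) v * f (edge_of h)).
  by apply: eq_bigr => h /eqP <-; rewrite tau_atE.
rewrite (partition_big (@edge_of G) (fun e => v \in ends e)) /=; last first.
  by move=> h /eqP <-; apply: (valP h).
apply: eq_bigr => e ve.
rewrite (big_pred1 (exist _ (e, v) ve : half_edge G)) // => h.
rewrite [RHS]/= -(inj_eq val_inj) [val h]surjective_pairing xpair_eqE andbC.
by [].
Qed.

End Incidence.

(** * Cuts by pairs of matching edges *)

(** In this section [adj] is adjacency by an edge outside a 1-factor and [mate]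
gives the other end of the edge of the 1-factor at a vertex, so a vertex set
that is invariant under [adj] is only crossed by edges of the 1-factor. *)
Section Cuts.
Variables (V : finType) (adj : rel V) (mate : V -> V).
Hypothesis mateK : involutive mate.
Hypothesis mate_neq : forall x, mate x != x.
Hypothesis adj_neq : forall x y, adj x y -> x != y.
Hypothesis adj_ex : forall x, exists y, adj x y.

Let crosses (a : pred V) x := a x (+) a (mate x).

(* The edges of the 1-factor with exactly one end among [u] and [v] are a
   cut. *)
Hypothesis pair_cut : forall u v, adj u v -> exists2 s : pred V,
  forall x y, adj x y -> s x = s y & crosses s =1 crosses (pred2 u v).

Let crosses_mate a x : crosses a (mate x) = crosses a x.
Proof. by rewrite /crosses mateK addbC. Qed.

Let crosses1 c x : crosses (pred1 c) x = (x == c) || (x == mate c).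
Proof.
rewrite /crosses /= (can2_eq mateK mateK).
by case: eqVneq => // ->; rewrite eq_sym (negbTE (mate_neq c)).
Qed.

Let crosses2 u v x : u != v -> mate u != v -> crosses (pred2 u v) x =
  [|| x == u, x == mate u, x == v | x == mate v].
Proof.
move=> uv m_uv; have m_vu : mate v != u.
  by apply: contraNneq m_uv => <-; rewrite mateK.
rewrite /crosses /= 2!(can2_eq mateK mateK).
have [->|_] := eqVneq x u.
  by rewrite (negbTE uv) eq_sym (negbTE (mate_neq u)) eq_sym (negbTE m_vu).
have [->|_] := eqVneq x v.
  by rewrite eq_sym (negbTE m_uv) eq_sym (negbTE (mate_neq v)) orbT.
by rewrite orbF /=.
Qed.

(** Complementing the side of the cut puts [u] and [v], which cannot be
separated because they are adjacent, outside and their mates inside. *)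
Lemma separating_cut u v : adj u v -> mate u != v -> exists s : pred V,
  [/\ [/\ ~~ s u, ~~ s v, s (mate u) & s (mate v)],
      forall x y, adj x y -> s x = s y &
      forall x, x \notin [:: u; mate u; v; mate v] -> s (mate x) = s x].
Proof.
move=> uv m_uv; have [s sadj s_uv] := pair_cut uv.
have {}s_uv x := etrans (s_uv x) (crosses2 x (adj_neq uv) m_uv).
exists (fun x => s x (+) s u); split=> [|x y /sadj->//|x].
  have := s_uv u; have := s_uv v; rewrite /crosses -(sadj _ _ uv) addbb.
  by rewrite !eqxx !orbT !(addbC (s u)) => -> ->.
by rewrite !inE -s_uv /crosses; case: (s x); case: (s (mate x)).
Qed.

(** Suppose that the edge from [y] to its mate is a cut with side [a], and let [w]
be a neighbour of [y]. Intersecting [a] with the cut for the pair [y], [w]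
yields a smaller side of a cut, by the edge at [w] alone; descend on the size. *)
Lemma no_mate_cut (a : pred V) y : a y ->
  (forall x z, adj x z -> a x = a z) -> ~ crosses a =1 crosses (pred1 y).
Proof.
have [n] := ubnP #|a|; elim: n => // n IHn in a y * => /ltnSE le_a_n ay aadj a1.
have {}a1 x := etrans (a1 x) (crosses1 y x).
have [w yw] := adj_ex y; have nyw := adj_neq yw.
have aw : a w by rewrite -(aadj _ _ yw).
have ay' : ~~ a (mate y) by have := a1 y; rewrite /crosses ay eqxx; case: (a _).
have ny'w : mate y != w by apply: contraNneq ay' => ->.
have aw' : a (mate w).
  have := a1 w; rewrite /crosses aw eq_sym (negbTE nyw) eq_sym (negbTE ny'w).
  by case: (a _).
have [s [[sy sw sy' sw'] sadj s_same]] := separating_cut yw ny'w.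
apply: (IHn [pred x | a x && s x] (mate w)) => /=; rewrite ?aw' ?sw' //.
- apply: leq_trans le_a_n; apply: proper_card; apply/properP; split.
    by apply/fintype.subsetP => x; rewrite !inE => /andP[].
  by exists y; rewrite // !inE (negbTE sy) andbF.
- by move=> x z xz; rewrite (aadj _ _ xz) (sadj _ _ xz).
move=> x; rewrite crosses1 mateK; symmetry.
have dy : ~~ crosses [pred x | a x && s x] y.
  by rewrite /crosses /= (negbTE sy) (negbTE ay') andbF.
have dw : crosses [pred x | a x && s x] w.
  by rewrite /crosses /= (negbTE sw) aw' sw' andbF.
have [->|nxw'] := eqVneq x (mate w); first by rewrite crosses_mate dw.
have [->|nxw] := eqVneq x w; first by rewrite dw.
have [->|nxy] := eqVneq x y; first by rewrite (negbTE dy).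
have [->|nxy'] := eqVneq x (mate y); first by rewrite crosses_mate (negbTE dy).
have := a1 x; rewrite /crosses /= s_same; last first.
  by rewrite !inE (negbTE nxy) (negbTE nxy') (negbTE nxw).
by rewrite (negbTE nxy) (negbTE nxy'); case: (a x); case: (a (mate x)) => //=;
  rewrite addbb.
Qed.

(** For distinct neighbours [w1] and [w2] of [c], the cuts for the pairs [c], [w1]
and [c], [w2] share only the edge at [c]; their sides not containing [c]
intersect in the side of a cut by that edge alone, against [no_mate_cut]. *)
Lemma adj_unique c w1 w2 : adj c w1 -> adj c w2 -> w1 = w2.
Proof.
(* A neighbour that is also the mate of [c] cannot be separated from [c], but
   the cut for any other neighbour does so. *)
have mate_stays w : mate c = w -> adj c w -> forall w', adj c w' -> w = w'.
  move=> m_cw cw w' cw'; apply/eqP; apply: contraT => nww'.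
  rewrite -m_cw in nww' cw.
  have [s [[sc _ smc _] sadj _]] := separating_cut cw' nww'.
  by rewrite (sadj _ _ cw) smc in sc.
move=> cw1 cw2.
have [m1|n1] := eqVneq (mate c) w1; first exact: (mate_stays w1).
have [m2|n2] := eqVneq (mate c) w2; first exact/esym/(mate_stays w2).
apply/eqP; apply: contraT => nw.
have [s1 [[s1c s1w s1c' s1w'] s1adj s1_same]] := separating_cut cw1 n1.
have [s2 [[s2c s2w s2c' s2w'] s2adj s2_same]] := separating_cut cw2 n2.
pose a := [pred x | s1 x && s2 x].
have /no_mate_cut[]: a (mate c) by rewrite /= s1c' s2c'.
  by move=> x z xz; rewrite /= (s1adj _ _ xz) (s2adj _ _ xz).
move=> x; rewrite crosses1 mateK.
(* Otherwise the cut [s2] would separate the neighbours [c] and [w1]. *)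
have nm : mate w1 != w2.
  apply: contraNneq s2c => m12.
  by rewrite (s2adj _ _ cw1) -[w1]mateK m12.
have nm' : w1 != mate w2 by apply: contraNneq nm => ->; rewrite mateK.
have nc1 := adj_neq cw1; have nc2 := adj_neq cw2.
have aw1' : ~~ s2 (mate w1).
  rewrite s2_same -?(s2adj _ _ cw1) // !inE eq_sym (negbTE nc1).
  by rewrite (eq_sym w1) (negbTE n1) (negbTE nw) (negbTE nm').
have aw2' : ~~ s1 (mate w2).
  rewrite s1_same -?(s1adj _ _ cw2) // !inE eq_sym (negbTE nc2).
  rewrite (eq_sym w2) (negbTE n2) (eq_sym w2 w1) (negbTE nw).
  by rewrite eq_sym (negbTE nm).
have ac : crosses a c by rewrite /crosses /= (negbTE s1c) s1c' s2c'.
have aw1 : ~~ crosses a w1.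
  by rewrite /crosses /= (negbTE s1w) (negbTE aw1') andbF.
have aw2 : ~~ crosses a w2.
  by rewrite /crosses /= (negbTE s2w) (negbTE aw2') andbF.
have [->|nxc'] := eqVneq x (mate c); first by rewrite crosses_mate ac.
have [->|nxc] := eqVneq x c; first by rewrite ac.
have [->|nxw1] := eqVneq x w1; first by rewrite (negbTE aw1).
have [->|nxw1'] := eqVneq x (mate w1);
  first by rewrite crosses_mate (negbTE aw1).
have [->|nxw2] := eqVneq x w2; first by rewrite (negbTE aw2).
have [->|nxw2'] := eqVneq x (mate w2);
  first by rewrite crosses_mate (negbTE aw2).
by rewrite /crosses /= s1_same ?s2_same ?addbb // !inE !negb_or; apply/and4P.
Qed.

End Cuts.

Lemma cards3_sum (T : finType) (A : {set T}) : #|A| = 3%N ->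
  exists x y z, A = [set x; y; z]%SET /\ forall (V : nmodType) (F : T -> V),
    \sum_(t in A) F t = F x + (F y + F z).
Proof.
move=> A3; have /card_gt0P[x xA] : (0 < #|A|)%N by rewrite A3.
have /eqP/cards2P[y [z [yz Axyz]]] : #|A :\ x| = 2%N.
  by move: A3; rewrite (cardsD1 x) xA => -[].
exists x, y, z; split=> [|V F].
  by rewrite -finset.setUA -Axyz finset.setD1K.
rewrite (big_setD1 x) //= Axyz big_setU1 ?inE //.
by rewrite big_set1.
Qed.

(** * Flows on cubic graphs *)

Section Spectra.
Variable R : realType.
Implicit Types (a b c : R).

Lemma zero_sum_ge2 a b c : a + (b + c) = 0 ->
  1 <= `|a| -> 1 <= `|b| -> 1 <= `|c| ->
  [|| 2 <= `|a|, 2 <= `|b| | 2 <= `|c|].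
Proof.
case: (ger0P a) => ?; case: (ger0P b) => ?; case: (ger0P c) => ? ? ? ? ?; lra.
Qed.

(** Two of the three have the same sign; the third is the sum of their absolute
values, which is at least 2, so these two are below 2 as the third is below 3.
The witness [s] is the sign of the third. *)
Lemma zero_sum_sign a b c : a + (b + c) = 0 ->
  1 <= `|a| < 3 -> 1 <= `|b| < 3 -> 1 <= `|c| < 3 ->
  exists s : bool, [/\ (a < 0) = s (+) (`|a| < 2), (b < 0) = s (+) (`|b| < 2)
                     & (c < 0) = s (+) (`|c| < 2)].
Proof.
case: (ger0P a) => ?; case: (ger0P b) => ?; case: (ger0P c) => ? ? ? ? ?;
  (try by lra);
  first [exists true; split; case: ltrP => //; lra
        |exists false; split; case: ltrP => //; lra].
Qed.

Section Flow.
Variable G : mgraph.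
Hypothesis cubicG : cubic G.

Lemma nzf_vertex (tau : half_edge G -> bool) (f : edge G -> R) v :
    boundary tau f v = 0 -> exists e1 e2 e3,
  [set e | v \in ends e]%SET = [set e1; e2; e3]%SET /\
  (let g e := (-1) ^+ tau_at tau e v * f e in g e1 + (g e2 + g e3) = 0).
Proof.
rewrite boundaryE; have [e1 [e2 [e3 [vE sumE]]]] := cards3_sum (cubicG v).
move=> df; exists e1, e2, e3; split=> //=.
rewrite -(sumE _ (fun e => (-1) ^+ tau_at tau e v * f e)) -[RHS]df.
by apply: eq_bigl => e; rewrite inE.
Qed.

Lemma admits_nzf_bound (sigma : signature G) (r : R) :
  admits_nzf sigma r -> exists tau (f : edge G -> R),
  [/\ orientation sigma tau, forall v, boundary tau f v = 0 &
      forall e, 1 <= `|f e| <= r - 1].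
Proof.
move=> [tau [f [ori [_ fe df] f0]]]; exists tau, f; split=> // e.
by case: (fe e) => // /eqP; rewrite (negbTE (f0 e)).
Qed.

Lemma nzf_ge3 (sigma : signature G) (r : R) (v : vert G) :
  admits_nzf sigma r -> 3 <= r.
Proof.
move=> /admits_nzf_bound[tau [f [_ df fe]]].
have [e1 [e2 [e3 [_ g0]]]] := nzf_vertex (df v).
have := zero_sum_ge2 g0; rewrite !normrMsign.
move: (fe e1) (fe e2) (fe e3) => /andP[-> ?] /andP[-> ?] /andP[-> ?].
by move=> /(_ isT isT isT)/or3P[] ?; lra.
Qed.

(** At each vertex, the sign of the flow on a half-edge tells whether the absolute
value is below 2, up to one sign [s] for the vertex. Comparing the two
half-edges of an edge, its own value cancels and leaves the two signs [s]. *)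
Lemma nzf_lt4_antibalanced (sigma : signature G) (r : R) :
  admits_nzf sigma r -> r < 4 -> antibalanced sigma.
Proof.
move=> /admits_nzf_bound[tau [f [/orientationE sE df fe]]] r4.
have /fin_all_exists[s sP] : forall v, exists s : bool,
    forall e, v \in ends e -> tau_at tau e v = s (+) (f e < 0) (+) (`|f e| < 2).
  move=> v; have [e1 [e2 [e3 [vE g0]]]] := nzf_vertex (df v).
  have fe3 e : 1 <= `|f e| < 3 by case/andP: (fe e) => ? ?; lra.
  have [] := zero_sum_sign g0; rewrite ?normrMsign // => s [s1 s2 s3].
  have fE e : ((-1) ^+ tau_at tau e v * f e < 0) = s (+) (`|f e| < 2) ->
      tau_at tau e v = s (+) (f e < 0) (+) (`|f e| < 2).
    have: f e != 0 by rewrite -normr_gt0; case/andP: (fe3 e) => ? ?; lra.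
    move=> f0; have pos : (0 < f e) = ~~ (f e < 0).
      by rewrite -leNgt le_eqVlt eq_sym (negbTE f0).
    case: (tau_at _ _ _); rewrite ?mulN1r ?mul1r ?oppr_lt0 ?pos;
      by case: (f e < 0); case: s {s1 s2 s3}; case: (_ < 2).
  exists s => e ve; have : e \in [set e | v \in ends e]%SET by rewrite inE.
  rewrite vE !inE.
  by case/orP=> [/orP[]|] /eqP->; apply: fE.
exists s => e; rewrite sE; congr (~~ _).
have [u [w [ew uw]]] := endsP e.
rewrite !(parityE _ ew uw) !sP ?ew ?inE ?eqxx ?orbT //.
by case: (s u); case: (s w); case: (_ < _); case: (_ < _).
Qed.

Definition top_signature (top : vert G -> edge G) : signature G :=
  fun e => ~~ parity (fun v => top v == e) e.

(** Orient the top half-edge at each vertex positively and the others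
negatively. *)
Lemma top_signature_nzf (top : vert G -> edge G) (f : edge G -> nat) (k : nat) :
    (1 < k)%N -> (forall v, v \in ends (top v)) ->
    (forall v, \sum_(e : edge G | (v \in ends e) && (e != top v)) f e =
       f (top v))%N ->
    (forall e, 0 < f e < k)%N ->
  admits_int_nzf R (top_signature top) k.
Proof.
move=> k1 vtop ftop fk.
pose tau := fun h : half_edge G => top (vert_of h) != edge_of h.
have tauE e v : v \in ends e -> tau_at tau e v = (top v != e).
  by move=> /(tau_at_mk (fun e v => top v != e)).
exists tau, (fun e => (f e)%:R); split=> [|||e].
- apply/orientationE => e; rewrite (eq_parity (tauE e)) /top_signature.
  have [u [w [ew uw]]] := endsP e; rewrite !(parityE _ ew uw).
  by case: (_ == _); case: (_ == _).
- split=> [|e|v]; first by rewrite ler_nat.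
    right; case/andP: (fk e) => f0 fltk; rewrite normr_nat ler1n f0 /=.
    by rewrite lerBrDr natr1 ler_nat.
  rewrite boundaryE (bigD1 (top v)) //= tauE // eqxx mul1r -ftop natr_sum.
  rewrite -big_split big1 //= => e /andP[ve]; rewrite eq_sym => ntop.
  by rewrite tauE // ntop mulN1r addrN.
- by move=> e; rewrite pnatr_eq0 -lt0n; case/andP: (fk e).
exact: natr_int.
Qed.

Lemma admits_int_nzfW (sigma : signature G) k :
  admits_int_nzf R sigma k -> admits_nzf sigma (k%:R : R).
Proof. by move=> [tau [f [? ? ? _]]]; exists tau, f. Qed.

(** An integer flow attaining the lower bound for real flows determines both
flow numbers. *)
Lemma in_spectra (sigma : signature G) (k : nat) :
    admits_int_nzf R sigma k ->
    (forall r : R, admits_nzf sigma r -> k%:R <= r) ->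
  (flow_spectrum G `&` int_flow_spectrum G)%classic (k%:R : R).
Proof.
move=> sk ksup; have adm := admits_int_nzfW sk.
split; exists sigma; split; try by exists k%:R.
  apply/eqP; rewrite eq_le; apply/andP; split.
    by apply: ereal_inf_lbound; exists k%:R.
  by apply/ereal_infP => _ [r /ksup kr <-]; rewrite lee_fin.
rewrite /int_flow_number; case: pselect => [ex|[]]; last first.
  by exists k; apply/asboolP.
case: ex_minnP => m /asboolP sm m_min; do 2 congr (_ _); apply/eqP.
rewrite eqn_leq m_min; last exact/asboolP.
by rewrite -(ler_nat R) ksup //; apply: admits_int_nzfW.
Qed.

End Flow.
End Spectra.

(** * Parallel edges outside a 1-factor *)

Section Digons.
Local Open Scope nat_scope.
Variable G : mgraph.
Implicit Types (M : {set edge G}) (e : edge G) (u v w : vert G).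
Hypothesis cubicG : cubic G.

Definition shared_ends (N : {set edge G}) := forall e e' u,
  e \in N -> e' \in N -> u \in ends e -> u \in ends e' -> ends e = ends e'.

Lemma one_factor_edge M : one_factor M -> exists m : vert G -> edge G,
  [/\ forall v, m v \in M, forall v, v \in ends (m v) &
      forall e v, e \in M -> v \in ends e -> e = m v].
Proof.
move=> M1.
have /fin_all_exists[m mP] v : exists e, [set e in M | v \in ends e] = [set e].
  by apply/cards1P; rewrite M1.
exists m; split=> [v|v|e v eM ve].
- by have := set11 (m v); rewrite -mP inE => /andP[].
- by have := set11 (m v); rewrite -mP inE => /andP[].
by apply/finset.set1P; rewrite -mP inE eM.
Qed.

Lemma card_off_factor M v : one_factor M -> #|[set e | v \in ends e] :\: M| = 2.
Proof.
move=> M1; have := cardsID M [set e | v \in ends e].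
rewrite cubicG finset.setIC.
have -> : M :&: [set e | v \in ends e] = [set e in M | v \in ends e].
  by apply/finset.setP => e; rewrite !inE.
by rewrite M1 => -[].
Qed.

(** The hypothesis says that the edges of [M] with exactly one end in [e0] form
a cut, so [adj_unique] applies to adjacency by edges outside [M]. *)
Lemma digons_off_factor M : one_factor M ->
    (forall e0, e0 \notin M -> exists s : vert G -> bool, forall e,
       parity s e = (e \in M) && parity (mem (ends e0)) e) ->
  shared_ends (~: M).
Proof.
move=> M1 Mcut; have [m [mM vm mE]] := one_factor_edge M1.
have /fin_all_exists2[mate mateE mate_neq] v :
    exists2 w, ends (m v) = [set v; w] & w != v.
  by have [w ew vw] := ends_at (vm v); exists w; rewrite 1?eq_sym.
have m_mate v : m (mate v) = m v.
  by apply/esym/mE; rewrite ?mM // mateE !inE eqxx orbT.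
have mateK : involutive mate.
  move=> v; have : v \in ends (m (mate v)) by rewrite m_mate.
  by rewrite mateE !inE eq_sym (negbTE (mate_neq v)) => /eqP.
pose adj := [rel u w |
  [exists e, (e \notin M) && (ends e == [set u; w])] && (u != w)].
have adjI e u w : e \notin M -> ends e = [set u; w] -> u != w -> adj u w.
  move=> eM ew uw; rewrite /= uw andbT; apply/existsP; exists e.
  by rewrite eM ew eqxx.
have adj_neq u w : adj u w -> u != w by case/andP.
have adj_ex u : exists w, adj u w.
  have /card_gt0P[e] : 0 < #|[set e | u \in ends e] :\: M|.
    by rewrite card_off_factor.
  rewrite !inE => /andP[eM ue]; have [w ew uw] := ends_at ue.
  by exists w; apply: adjI ew uw.
have pair_cut u v : adj u v -> exists2 s : pred (vert G),
    forall x y, adj x y -> s x = s y &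
    (fun x => s x (+) s (mate x)) =1
    (fun x => pred2 u v x (+) pred2 u v (mate x)).
  case/andP=> /existsP[e0 /andP[e0M /eqP e0E]] uv.
  have [s sP] := Mcut _ e0M; exists s => [x y|x].
    case/andP=> /existsP[e /andP[eM /eqP eE]] xy.
    have := sP e; rewrite (negbTE eM) (parityE _ eE xy).
    by case: (s x); case: (s y).
  have := sP (m x); rewrite mM !(parityE _ (mateE x)) 1?eq_sym //= => ->.
  by rewrite !e0E !inE.
have uniq := adj_unique mateK mate_neq adj_neq adj_ex pair_cut.
move=> e e' u; rewrite !inE => eM e'M ue ue'.
have [w ew uw] := ends_at ue; have [w' ew' uw'] := ends_at ue'.
by rewrite ew ew' (uniq _ _ _ (adjI _ _ _ eM ew uw) (adjI _ _ _ e'M ew' uw')).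
Qed.

(** Choosing an edge by its set of ends selects the same edge of a digon from
both of its vertices. *)
Lemma digon_factor M : one_factor M -> shared_ends (~: M) ->
  exists2 M', one_factor M' & [disjoint M & M'].
Proof.
move=> M1 Mdig.
pose p S := [pick e | (e \notin M) && (ends e == S)].
exists [set e | (e \notin M) && (p (ends e) == Some e)] => [v|]; last first.
  by rewrite disjoint_subset; apply/fintype.subsetP => e eM; rewrite !inE eM.
have /card_gt0P[e] : 0 < #|[set e | v \in ends e] :\: M|.
  by rewrite card_off_factor.
rewrite !inE => /andP[eM ve].
have : exists2 e1, p (ends e) = Some e1 & (e1 \notin M) && (ends e1 == ends e).
  rewrite /p; case: pickP => [e1 e1P|/(_ e)]; first by exists e1.
  by rewrite eM eqxx.
case=> e1 pe1 /andP[e1M /eqP e1E].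
apply/eqP/cards1P; exists e1; apply/finset.setP => x; rewrite !inE.
apply/andP/eqP => [[/andP[xM /eqP px] vx]|->]; last by rewrite e1M e1E pe1 eqxx.
by apply: Some_inj; rewrite -px -pe1 (Mdig x e v) // inE.
Qed.

(** Both for [M] and for a 1-factor disjoint from [M], the two other edges at
a vertex are parallel. These two pairs of edges overlap in the third edge. *)
Lemma all_shared_ends : (exists M, one_factor M) ->
    (forall M, one_factor M -> shared_ends (~: M)) -> shared_ends [set: edge G].
Proof.
move=> [M M1] dig; have Mdig := dig M M1.
have [M' M'1 dMM'] := digon_factor M1 Mdig; have M'dig := dig M' M'1.
have [m' [m'M' vm' m'E]] := one_factor_edge M'1.
have M_M' e : e \in M -> e \notin M' by move/(disjointFr dMM') ->.
(* Two edges at [u] lie outside [M], and only one of them is in [M']. *)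
have link u : exists e, [/\ e \notin M, e \notin M' & u \in ends e].
  have : 0 < #|([set e | u \in ends e] :\: M) :\ m' u|.
    have := cardsD1 (m' u) ([set e | u \in ends e] :\: M).
    by rewrite card_off_factor //; case: #|_ :\ _|; case: (_ \in _).
  case/card_gt0P=> e; rewrite !inE => /and3P[em' eM ue]; exists e; split=> //.
  by apply: contra em' => eM'; rewrite -(m'E _ _ eM' ue).
suff to_link e e' u : u \in ends e -> u \in ends e' -> e' \notin M ->
    e' \notin M' -> ends e = ends e'.
  move=> e e' u _ _ ue ue'; have [e2 [e2M e2M' ue2]] := link u.
  by rewrite (to_link e e2 u) // (to_link e' e2 u).
move=> ue ue' e'M e'M'; have [eM|eM] := boolP (e \in M).
  by apply: (M'dig e e' u); rewrite // inE // M_M'.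
by apply: (Mdig e e' u); rewrite ?inE.
Qed.

End Digons.

(** * Disjoint unions of copies of the cubic graph on two vertices *)

(** Number the elements of each fibre by [enum_rank_in]. *)
Lemma bijective_fibres (T I : finType) (k : nat) (p : T -> I) :
    (forall i, #|[set x | p x == i]| = k) ->
  exists2 g : T -> I * 'I_k, bijective g & forall x, (g x).1 = p x.
Proof.
move=> pk; pose fib i := [set x | p x == i].
have pin x : x \in fib (p x) by rewrite inE.
pose g x := (p x, cast_ord (pk (p x)) (enum_rank_in (pin x) x)).
pose g' (y : I * 'I_k) := enum_val (cast_ord (esym (pk y.1)) y.2).
have gK : cancel g g' by move=> x; rewrite /g' cast_ordK enum_rankK_in.
have pg' y : p (g' y) = y.1.
  by have := enum_valP (cast_ord (esym (pk y.1)) y.2); rewrite inE => /eqP.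
have g'_inj : injective g'.
  move=> [i j] [i' j'] eg; have := pg' (i, j); rewrite eg pg' /= => ii'.
  by move: eg; rewrite -ii' => /enum_val_inj/cast_ord_inj/= ->.
by exists g => //; exists g' => //; apply: inj_can_sym gK g'_inj.
Qed.

(** The components are indexed by the sets of ends of edges; the edges and the
vertices of each are numbered by [bijective_fibres]. The numberings need not be
related, since in [K23] every edge is incident with every vertex. *)
Lemma shared_ends_copies (G : mgraph) : cubic G -> shared_ends [set: edge G] ->
  exists n, mgraph_iso G (copies n K23).
Proof.
move=> cubicG share.
have /fin_all_exists[a va] (v : vert G) : exists e, v \in ends e.
  have /card_gt0P[e] : (0 < #|[set e | v \in ends e]|)%N by rewrite cubicG.
  by rewrite inE; exists e.
pose I : finType := {S | S \in @ends G @: finset.setT}.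
pose part e : I := Sub (ends e) (imset_f _ (finset.in_setT e)).
pose pe e : 'I_#|I| := enum_rank (part e).
have pe_ends e e' : (pe e == pe e') = (ends e == ends e').
  by rewrite (inj_eq enum_rank_inj) -val_eqE.
have pe_at e e' u : u \in ends e -> (pe e' == pe e) = (u \in ends e').
  move=> ue; rewrite pe_ends; apply/eqP/idP => [->//|ue'].
  by apply: share ue' ue; rewrite inE.
have peS i : exists e, i = pe e.
  have /finset.imsetP[e _ ei] := valP (enum_val i); exists e.
  by apply: enum_val_inj; rewrite enum_rankK; apply: val_inj.
have [psi psi_bij psi1] : exists2 g : edge G -> 'I_#|I| * 'I_3,
    bijective g & forall e, (g e).1 = pe e.
  apply: bijective_fibres => i; have [e ->] := peS i.
  have [u [w [ew _]]] := endsP e.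
  rewrite -[RHS](cubicG u); apply: eq_card => e'.
  by rewrite !inE (@pe_at e e' u) // ew !inE eqxx.
have [phi phi_bij phi1] : exists2 g : vert G -> 'I_#|I| * 'I_2,
    bijective g & forall v, (g v).1 = pe (a v).
  apply: bijective_fibres => i; have [e ->] := peS i.
  rewrite -[RHS](card_ends e); apply: eq_card => v.
  by rewrite !inE eq_sym (pe_at (a v) e v).
exists #|I|, phi, psi; split=> // e.
(* Both sides have two elements, so one inclusion is enough. *)
apply/esym/eqP; rewrite eqEcard; apply/andP; split; last first.
  by rewrite card_imset ?card_ends //; apply: bij_inj.
apply/fintype.subsetP => _ /finset.imsetP[v ve ->].
apply/finset.imsetP; exists (phi v).2; rewrite ?inE //.
rewrite [LHS]surjective_pairing phi1 psi1; congr pair; apply/eqP.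
by rewrite (pe_at e (a v) v).
Qed.

(** * Flows from a 1-factor *)

Section Signatures.
Variables (R : realType) (G : mgraph) (M : {set edge G}) (m : vert G -> edge G).
Hypothesis cubicG : cubic G.
Hypothesis M1 : one_factor M.
Hypothesis mM : forall v, m v \in M.
Hypothesis vm : forall v, v \in ends (m v).
Hypothesis mE : forall e v, e \in M -> v \in ends e -> e = m v.

Lemma sum_factor v : (\sum_(e | v \in ends e) (e \in M).+1 = 4)%N.
Proof.
under eq_bigr do rewrite -add1n.
rewrite big_split /= sum1dep_card cubicG -big_mkcondr /= sum1dep_card.
rewrite -[RHS]/(3 + 1)%N; congr (_ + _)%N.
by rewrite -[RHS](M1 v); apply: eq_card => e; rewrite !inE andbC.
Qed.

Lemma factor_3flow : admits_int_nzf R (top_signature m) 3.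
Proof.
apply: (@top_signature_nzf _ _ _ (fun e => (e \in M).+1)) => // [v|e].
  by have := sum_factor v; rewrite (bigD1 (m v)) //= mM => -[].
by case: (e \in M).
Qed.

Variable e0 : edge G.
Hypothesis e0M : e0 \notin M.

(** The top edges once [e0] has the value 3. *)
Definition raised v := if v \in ends e0 then e0 else m v.

Lemma raised_4flow : admits_int_nzf R (top_signature raised) 4.
Proof.
apply: (@top_signature_nzf _ _ _
  (fun e => if e == e0 then 3 else (e \in M).+1)) => // [v|v|e].
- by rewrite /raised; case: ifP.
- have fE e : e != e0 -> (if e == e0 then 3 else (e \in M).+1) = (e \in M).+1.
    by move/negbTE->.
  rewrite /raised; have [ve0|ve0] := ifPn.
    rewrite eqxx; have := sum_factor v; rewrite (bigD1 e0) //= (negbTE e0M).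
    by rewrite add1n => -[S]; rewrite -[RHS]S; apply: eq_bigr => e /andP[_ /fE].
  have nm : m v != e0 by apply: contraNneq ve0 => <-.
  have := sum_factor v; rewrite (bigD1 (m v)) //= fE // mM add2n => -[S].
  rewrite -[RHS]S; apply: eq_bigr => e /andP[ve _]; apply: fE.
  by apply: contraNneq ve0 => <-.
by case: ifP => // _; case: (e \in M).
Qed.

Lemma raised_parity e : parity (fun v => raised v == e) e =
  (e \in M) && parity (mem (ends e0)) e.
Proof.
have [u [w [ew uw]]] := endsP e.
have ue : u \in ends e by rewrite ew !inE eqxx.
have we : w \in ends e by rewrite ew !inE eqxx orbT.
rewrite !(parityE _ ew uw) /raised /=.
have [eM|eM] /= := boolP (e \in M).
  rewrite -(mE eM ue) -(mE eM we).
  have /negbTE ne0 : e0 != e by apply: contraNneq e0M => ->.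
  by case: ifP; case: ifP; rewrite ?ne0 ?eqxx.
have nm v : m v == e = false by apply: contraNF eM => /eqP <-.
have [->|ne] := eqVneq e0 e; first by rewrite ue we eqxx.
by case: ifP; case: ifP; rewrite ?(negbTE ne) ?nm.
Qed.

End Signatures.

(** If the signature obtained from [M] by raising [e0] is antibalanced, the sign
changes at its vertices give the cut required by [digons_off_factor]. *)
Lemma exists_not_antibalanced (G : mgraph) : cubic G ->
    (exists M : {set edge G}, one_factor M) ->
    (forall n, ~ mgraph_iso G (copies n K23)) ->
  exists sigma : signature G,
    ~ antibalanced sigma /\ forall R : realType, admits_int_nzf R sigma 4.
Proof.
move=> cubicG factorG neqG; apply: contrapT => no_sigma.
have [] := shared_ends_copies cubicG; last by move=> n; apply: neqG.
apply: all_shared_ends => // M M1; apply: digons_off_factor => // e0 e0M.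
have [m [mM vm mE]] := one_factor_edge M1.
apply: contrapT => no_s; apply: no_sigma; exists (top_signature (raised m e0)).
split; last by move=> R; apply: raised_4flow.
case=> s sE; apply: no_s; exists s => e.
by rewrite -(raised_parity mM mE e0M); apply/negb_inj/esym/sE.
Qed.

Local Open Scope classical_set_scope.

Theorem theorem6p4 (R : realType) (G : mgraph)
    (cubicG : cubic G)
    (factorG : exists M : {set edge G}, one_factor M)
    (neqG : forall n : nat, ~ mgraph_iso G (copies n K23)) :
  [set (3 : R); (4 : R)] `<=` flow_spectrum G `&` int_flow_spectrum G.
Proof.
move=> _ [->|->].
  have [M M1] := factorG; have [m [mM vm mE]] := one_factor_edge M1.
  have [v _|V0] := pickP (@predT (vert G)).
    apply: (in_spectra (sigma := top_signature m)); first exact: factor_3flow.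
    by move=> r; apply: nzf_ge3.
  (* The graph without vertices is the union of no copies. *)
  have [] := shared_ends_copies cubicG; last by move=> n /neqG.
  by move=> e e' u; have := V0 u.
have [sigma [nsigma s4]] := exists_not_antibalanced cubicG factorG neqG.
apply: (in_spectra (s4 R)) => r sr; rewrite leNgt.
by apply/negP => /(nzf_lt4_antibalanced cubicG sr).
Qed.
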